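(* There exist a $*$-probability space $(\mathcal A,\varphi)$ and an $R$-diagonal pair $(x,y)$ of random variables in $\mathcal A$ such that the pairs $(xx^*,yy^* )$ and $(x^*x,y^*y)$ are not bi-free.
   Context: A $*$-probability space $(\mathcal A,\varphi)$ is a unital $*$-algebra $\mathcal A$ over $\mathbb C$ with a linear functional $\varphi$ such that $\varphi(1)=1$ and $\varphi(a^* )=\overline{\varphi(a)}$. For $\chi:\{1,\dots,n\}\to\{l,r\}$, the permutation $s_\chi$ of $\{1,\dots,n\}$ is defined by $\chi^{-1}(\{l\})=\{s_\chi(1)<\cdots<s_\chi(k)\}$ and $\chi^{-1}(\{r\})=\{s_\chi(k+1)>\cdots>s_\chi(n)\}$. The set of bi-non-crossing partitions is $BNC(\chi)=\{s_\chi\cdot\pi:\pi\in NC(n)\}$, where $NC(n)$ is the set of non-crossing partitions and $s_\chi\cdot\pi$ is obtained by applying $s_\chi$ to the blocks of $\pi$. The bi-free cumulants $\kappa_\chi:\mathcal A^n\to\mathbb C$ are the multilinear functionals determined recursively by $\varphi(a_1\cdots a_n)=\sum_{\pi\in BNC(\chi)}\prod_{V\in\pi}\kappa_{\chi|_V}((a_1,\dots,a_n)|_V)$, where for $V=\{i_1<\dots<i_m\}$, $(a_1,\dots,a_n)|_V=(a_{i_1},\dots,a_{i_m})$ and $\chi|_V$ is regarded as a map on $\{1,\dots,m\}$ by order-preserving relabelling. Two pairs $(a_1,b_1)$, $(a_2,b_2)$ (first entries left variables, second entries right variables) are bi-free if and only if all mixed bi-free cumulants vanish: $\kappa_\chi(d_1,\dots,d_n)=0$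 whenever $n\ge2$, $\epsilon:\{1,\dots,n\}\to\{1,2\}$ is non-constant, and $d_k=a_{\epsilon(k)}$ if $\chi(k)=l$, $d_k=b_{\epsilon(k)}$ if $\chi(k)=r$. $R$-diagonal pair: $(x,y)$ is $R$-diagonal if, for all $\chi:\{1,\dots,m\}\to\{l,r\}$ and all $z_1,\dots,z_m$ with $z_i\in\{x,x^*\}$ when $\chi(i)=l$ and $z_i\in\{y,y^*\}$ when $\chi(i)=r$, one has $\kappa_\chi(z_1,\dots,z_m)=0$ unless $m=2n$ is even and $(z_{s_\chi(1)},\dots,z_{s_\chi(2n)})=(x^{\omega(1)},\dots,x^{\omega(k)},y^{\omega(k+1)},\dots,y^{\omega(2n)})$ for some $0\le k\le2n$ and some alternating $\omega:\{1,\dots,2n\}\to\{1,*\}$ ($\omega(i)\ne\omega(i+1)$ for all $i$). *)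

(* Defs.v *)
From HB Require Import structures.
From mathcomp Require Import all_boot all_order all_fingroup all_algebra.
From mathcomp Require Import boolp reals complex.

Set Implicit Arguments.
Unset Strict Implicit.
Unset Printing Implicit Defensive.

Import Order.TTheory GRing.Theory Num.Theory.
Local Open Scope ring_scope.

(* As usual for *-algebras, positivity of the functional is not assumed. *)
Record star_prob_space (R : realType) := StarProbSpace {
  carrier :> algType R[i];
  adj : carrier -> carrier;
  adjD : forall a b, adj (a + b) = adj a + adj b;
  adjZ : forall (c : R[i]) a, adj (c *: a) = c^* *: adj a;
  adjM : forall a b, adj (a * b) = adj b * adj a;
  adjK : involutive adj;
  state : {scalar carrier};
  state1 : state 1 = 1;
  state_adj : forall a, state (adj a) = (state a)^*
}.

Inductive side := sl | sr.

Definition is_left (s : side) : bool := if s is sl then true else false.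

Definition noncrossing (n : nat) (pi : {set {set 'I_n}}) : bool :=
  partition pi [set: 'I_n] &&
  [forall V in pi, forall W in pi, (V != W) ==>
    ~~ [exists i in V, exists j in W, exists k in V, exists l in W,
         [&& i < j, j < k & k < l]%N]].

Definition NC (n : nat) : {set {set {set 'I_n}}} :=
  [set pi | noncrossing pi].

(* The left indices in increasing order, then the right indices in decreasing
   order: the list s_chi(1), ..., s_chi(n). *)
Definition schi_seq (n : nat) (chi : 'I_n -> side) : seq 'I_n :=
  [seq i <- enum 'I_n | is_left (chi i)] ++
  rev [seq i <- enum 'I_n | ~~ is_left (chi i)].

Lemma perm_schi_seq (n : nat) (chi : 'I_n -> side) :
  perm_eq (schi_seq chi) (enum 'I_n).
Proof.
apply: (@perm_trans _ ([seq i <- enum 'I_n | is_left (chi i)] ++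
   [seq i <- enum 'I_n | ~~ is_left (chi i)])).
  by rewrite perm_cat2l perm_rev.
by rewrite perm_filterC.
Qed.

Lemma schi_inj (n : nat) (chi : 'I_n -> side) :
  injective (fun i : 'I_n => nth i (schi_seq chi) i).
Proof.
have sz : size (schi_seq chi) = n.
  by rewrite (perm_size (perm_schi_seq chi)) size_enum_ord.
have un : uniq (schi_seq chi).
  by rewrite (perm_uniq (perm_schi_seq chi)) enum_uniq.
move=> i j /=; rewrite (set_nth_default i) ?sz // => /eqP.
by rewrite nth_uniq ?sz // => /eqP/val_inj.
Qed.

Definition schi (n : nat) (chi : 'I_n -> side) : 'S_n := perm (@schi_inj n chi).

Definition BNC (n : nat) (chi : 'I_n -> side) : {set {set {set 'I_n}}} :=
  [set [set schi chi @: V | V : {set 'I_n} in pi] | pi : {set {set 'I_n}} in NC n].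

(* enum_val : 'I_#|V| -> 'I_n is the increasing enumeration of V. *)
Definition restrict (T : Type) (n : nat) (f : 'I_n -> T) (V : {set 'I_n}) :
    'I_#|V| -> T := fun i => f (enum_val i).
Arguments restrict {T n} f V _.

(* The moment-cumulant formula solved for the term of the one-block partition;
   [fuel] bounds the recursion depth, and n is always enough since every block
   of another partition has fewer than n elements.  See moment_cumulant and
   cumulant_unique. *)
Fixpoint cumulant_rec (R : realType) (A : star_prob_space R) (fuel n : nat)
    (chi : 'I_n -> side) (a : 'I_n -> A) {struct fuel} : R[i] :=
  if fuel is fuel'.+1 then
    state A (\prod_(i < n) a i) -
    \sum_(pi in BNC chi | pi != [set [set: 'I_n]])
      \prod_(V in pi) cumulant_rec fuel' (restrict chi V) (restrict a V)
  else 0.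

Definition cumulant (R : realType) (A : star_prob_space R) (n : nat)
    (chi : 'I_n -> side) (a : 'I_n -> A) : R[i] :=
  cumulant_rec n chi a.

Lemma BNC_partition (n : nat) (chi : 'I_n -> side) (pi : {set {set 'I_n}}) :
  pi \in BNC chi -> partition pi [set: 'I_n].
Proof.
case/imsetP => rho; rewrite inE => /andP[prho _] ->.
have sT : schi chi @: [set: 'I_n] = [set: 'I_n].
  apply/setP => i; rewrite inE; apply/imsetP.
  by exists ((schi chi)^-1%g i); rewrite ?inE ?permKV.
rewrite -sT; apply: (_ : partition ((fun V : {set 'I_n} => schi chi @: V) @: rho) _).
by rewrite imset_partition //; exact: perm_inj.
Qed.

Lemma block_lt (n : nat) (pi : {set {set 'I_n}}) (V : {set 'I_n}) :
  partition pi [set: 'I_n] -> pi != [set [set: 'I_n]] -> V \in pi ->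
  (#|V| < n)%N.
Proof.
move=> Ppi pin1 Vpi; have [covpi /trivIsetP tripi n0pi] := and3P Ppi.
suff : V \proper [set: 'I_n] by move/proper_card; rewrite cardsT card_ord.
rewrite properT; apply: contra pin1 => /eqP VT.
rewrite eqEsubset sub1set -{2}VT Vpi andbT; apply/subsetP => W Wpi.
rewrite inE; apply: contraNT n0pi => WnT; rewrite -VT in WnT.
have := tripi _ _ Wpi Vpi WnT; rewrite VT -setI_eq0 setIT => /eqP <-.
exact: Wpi.
Qed.

Lemma cumulant_rec_fuel (R : realType) (A : star_prob_space R) (f g n : nat)
    (chi : 'I_n -> side) (a : 'I_n -> A) :
  (0 < n)%N -> (n <= f)%N -> (n <= g)%N ->
  cumulant_rec f chi a = cumulant_rec g chi a.
Proof.
elim: f g n chi a => [|f IH] [|g] n chi a n0; rewrite ?leqn0 /=.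
- by move=> /eqP n00; rewrite n00 in n0.
- by move=> /eqP n00; rewrite n00 in n0.
- by move=> _ /eqP n00; rewrite n00 in n0.
move=> nf ng; congr (_ - _); apply: eq_bigr => pi /andP[piB pin1].
apply: eq_bigr => V Vpi; have Ppi := BNC_partition piB.
have Vn := block_lt Ppi pin1 Vpi.
apply: IH; [|exact: leq_trans Vn nf|exact: leq_trans Vn ng].
rewrite card_gt0; have [_ _] := and3P Ppi.
by apply: contraNneq => <-.
Qed.

Lemma cumulant_restrictT (R : realType) (A : star_prob_space R) (n : nat)
    (K : forall m : nat, ('I_m -> side) -> ('I_m -> A) -> R[i])
    (chi : 'I_n -> side) (a : 'I_n -> A) :
  K _ (restrict chi [set: 'I_n]) (restrict a [set: 'I_n]) = K n chi a.
Proof.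
have aux (m : nat) (g : 'I_m -> 'I_n) : m = n -> (forall i, g i = i :> nat) ->
    K m (fun i => chi (g i)) (fun i => a (g i)) = K n chi a.
  move=> mn; move: g; rewrite mn => g gE.
  by congr (K n _ _); apply/funext => i; congr (_ _); apply/val_inj/gE.
apply: (aux _ (@enum_val _ [set: 'I_n])); first by rewrite cardsT card_ord.
move=> i; have iT : (i < n)%N.
  by apply: (leq_trans (ltn_ord i)); rewrite cardsT card_ord.
rewrite (enum_val_nth (Ordinal iT)) enum_setT -enumT.
by rewrite nth_enum_ord.
Qed.

Lemma setT1_BNC (n : nat) (chi : 'I_n -> side) :
  (0 < n)%N -> [set [set: 'I_n]] \in BNC chi.
Proof.
move=> n0; have sT : schi chi @: [set: 'I_n] = [set: 'I_n].
  apply/setP => i; rewrite inE; apply/imsetP.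
  by exists ((schi chi)^-1%g i); rewrite ?inE ?permKV.
apply/imsetP; exists [set [set: 'I_n]]; last by rewrite imset_set1 sT.
rewrite inE; apply/andP; split.
  apply/and3P; split; first by rewrite /cover big_set1.
    apply/trivIsetP => V W; rewrite !inE => /eqP -> /eqP ->.
    by rewrite eqxx.
  rewrite inE; apply/eqP => /setP/(_ (Ordinal n0)).
  by rewrite !inE.
apply/forall_inP => V; rewrite inE => /eqP ->.
by apply/forall_inP => W; rewrite inE => /eqP ->; rewrite eqxx.
Qed.

Lemma BNC0 (chi : 'I_0 -> side) : BNC chi = [set set0].
Proof.
have E0 (pi : {set {set 'I_0}}) : partition pi [set: 'I_0] -> pi = set0.
  move=> /and3P[_ _ n0]; apply/setP => V; rewrite inE.
  apply: contraNF n0 => Vpi; suff -> : set0 = V by [].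
  by apply/setP => -[].
apply/setP => pi; rewrite inE; apply/idP/eqP => [/BNC_partition/E0 //|->].
apply/imsetP; exists set0; last by rewrite imset0.
rewrite inE; apply/andP; split.
  apply/and3P; split; rewrite ?inE //; last by apply/trivIsetP => V W; rewrite inE.
  by rewrite /cover big_set0; apply/eqP/setP => -[].
by apply/forall_inP => V; rewrite inE.
Qed.

Theorem moment_cumulant (R : realType) (A : star_prob_space R) (n : nat)
    (chi : 'I_n -> side) (a : 'I_n -> A) :
  state A (\prod_(i < n) a i) =
  \sum_(pi in BNC chi) \prod_(V in pi) cumulant (restrict chi V) (restrict a V).
Proof.
case: n chi a => [|n] chi a.
  by rewrite BNC0 big_set1 big_set0 big_ord0 state1.
rewrite (bigD1 [set [set: 'I_n.+1]]) ?setT1_BNC //= big_set1.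
rewrite (cumulant_restrictT (@cumulant R A)) {1}/cumulant /=.
rewrite -[LHS](subrK (\sum_(pi in BNC chi | pi != [set [set: 'I_n.+1]])
  \prod_(V in pi) cumulant_rec n (restrict chi V) (restrict a V))).
congr (_ + _); apply: eq_bigr => pi /andP[piB pin1].
apply: eq_bigr => V Vpi; have Ppi := BNC_partition piB.
have Vn := block_lt Ppi pin1 Vpi.
apply: cumulant_rec_fuel => //; rewrite card_gt0.
by have [_ _] := and3P Ppi; apply: contraNneq => <-.
Qed.

Theorem cumulant_unique (R : realType) (A : star_prob_space R)
    (K : forall n : nat, ('I_n -> side) -> ('I_n -> A) -> R[i]) :
  (forall (n : nat) (chi : 'I_n -> side) (a : 'I_n -> A), (0 < n)%N ->
    state A (\prod_(i < n) a i) =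
    \sum_(pi in BNC chi) \prod_(V in pi) K _ (restrict chi V) (restrict a V)) ->
  forall (n : nat) (chi : 'I_n -> side) (a : 'I_n -> A), (0 < n)%N ->
    K n chi a = cumulant chi a.
Proof.
move=> KE n; have [m] := ubnP n; elim: m n => // m IH n.
rewrite ltnS => nm chi a n0.
have := moment_cumulant chi a; rewrite (KE n chi a n0).
rewrite (bigD1 [set [set: 'I_n]]) ?setT1_BNC //= big_set1.
rewrite [RHS](bigD1 [set [set: 'I_n]]) ?setT1_BNC //= big_set1.
rewrite (cumulant_restrictT K) (cumulant_restrictT (@cumulant R A)).
rewrite (eq_bigr (fun pi : {set {set 'I_n}} => \prod_(V in pi)
  cumulant (restrict chi V) (restrict a V))); first exact: addIr.
move=> pi /andP[piB pin1]; apply: eq_bigr => V Vpi.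
have Ppi := BNC_partition piB; have Vn := block_lt Ppi pin1 Vpi.
apply: IH; first exact: leq_trans Vn nm.
rewrite card_gt0; have [_ _] := and3P Ppi.
by apply: contraNneq => <-.
Qed.

(* z^true = z^*, z^false = z. *)
Definition starpow (R : realType) (A : star_prob_space R) (z : A) (e : bool) : A :=
  if e then adj z else z.

(* The word (z_1, ..., z_m) is read as a word in the four formal letters
   x, x^*, y, y^*: its i-th letter is the pair (chi i, eta i), so that accidental
   equalities between the elements x, x^*, y, y^* play no role. *)
Definition r_diagonal (R : realType) (A : star_prob_space R) (x y : A) : Prop :=
  forall (m : nat) (chi : 'I_m -> side) (eta : 'I_m -> bool),
    ~ (exists n k : nat, exists omega : 'I_m -> bool,
        [/\ m = (2 * n)%N, (k <= m)%N,
            forall i j : 'I_m, j = i.+1 :> nat -> omega i != omega j &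
            forall i : 'I_m, (chi (schi chi i), eta (schi chi i)) =
              (if (i < k)%N then sl else sr, omega i)]) ->
    cumulant chi
      (fun i => starpow (if is_left (chi i) then x else y) (eta i)) = 0.

Definition bi_free (R : realType) (A : star_prob_space R) (p1 p2 : A * A) : Prop :=
  forall (n : nat) (chi : 'I_n -> side) (eps : 'I_n -> bool),
    (2 <= n)%N -> (exists i j : 'I_n, eps i != eps j) ->
    cumulant chi
      (fun k => let p := if eps k then p2 else p1 in
                if is_left (chi k) then p.1 else p.2) = 0.

(* Main.v *)
Require Import Defs.
From HB Require Import structures.
From mathcomp Require Import all_boot all_order all_fingroup all_algebra.
From mathcomp Require Import boolp reals complex.
From mathcomp Require Import finmap.
From mathcomp.multinomials Require Import monalg.
(* Restores [is_left], which Stdlib's sumbool projection shadows. *)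
Import Defs.

(** Take the free *-algebra on x and y and let the only nonzero bi-free cumulants
    of the letters be kappa(x, y^* ) = kappa(x^*, y) = 1 (in either order of the
    two sides); such pairs are alternating, so (x, y) is R-diagonal.  In the order
    given by s_chi the left letters precede the right ones, so the only
    non-crossing partition into left-right pairs is the nested one.  Hence the
    state of a word is 1 if its left and right subwords, read from left to right,
    are letterwise dual (x against y^*, x^* against y), and 0 otherwise.  Then
    xx^* has state 0 while xx^*y^*y has state 1, so the mixed cumulant
    kappa_(l,r)(xx^*, y^*y) is nonzero. *)

Set Implicit Arguments.
Unset Strict Implicit.
Unset Printing Implicit Defensive.

Import GRing.Theory Num.Theory.
Local Open Scope ring_scope.

(** * Monoid algebras with the star and the functional extended from the monoid *)

Lemma malg_scaleAr (C : comNzRingType) (K : monomType) (c : C)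
    (g h : {malg C[K]}) :
  c *: (g * h) = g * (c *: h).
Proof.
apply/malgP => k; rewrite mcoeffZ mcoeffMl mulr_sumr.
rewrite (mcoeffMlw _ (fsubset_refl _) (msuppZ_le c h)).
apply: eq_bigr => k1 _; rewrite mulr_sumr; apply: eq_bigr => k2 _.
by rewrite mcoeffZ mulrnAr mulrCA.
Qed.

(* An alias: {malg C[K]} already has an algType instance, for commutative K only,
   which prevents declaring a more general one. *)
Definition monoid_alg (C : comNzRingType) (K : monomType) : Type := {malg C[K]}.
HB.instance Definition _ (C : comNzRingType) (K : monomType) :=
  GRing.Lalgebra.copy (monoid_alg C K) {malg C[K]}.
HB.instance Definition _ (C : comNzRingType) (K : monomType) :=
  GRing.Lalgebra_isAlgebra.Build C (monoid_alg C K) (@malg_scaleAr C K).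

Section StarAlgebra.
Context (C : numClosedFieldType) (K : monomType) (inv : K -> K).
Context (invK : involutive inv).
Context (invM : forall k l, inv (mmul k l) = mmul (inv l) (inv k)).

Definition malg_star (g : {malg C[K]}) : {malg C[K]} :=
  \sum_(k <- msupp g) << (g@_k)^* *g inv k >>.

(** Since [inv] is an involution, one basis element contributes to each coefficient; additivity,
    conjugate-linearity and involutivity can thus be checked coefficientwise. *)
Lemma mcoeff_star g k : (malg_star g)@_k = (g@_(inv k))^*.
Proof.
rewrite {2}(monalgE g) !raddf_sum /=; apply: eq_bigr => l _.
rewrite !mcoeffU (can2_eq invK invK).
by case: eqP; rewrite ?mulr1n ?mulr0n ?conjC0.
Qed.

Lemma malg_starD : {morph malg_star : g h / g + h}.
Proof. by move=> g h; apply/malgP => k; rewrite !(mcoeffD, mcoeff_star) rmorphD. Qed.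

Lemma malg_starZ c g : malg_star (c *: g) = c^* *: malg_star g.
Proof. by apply/malgP => k; rewrite !(mcoeffZ, mcoeff_star) rmorphM. Qed.

Lemma malg_starK : involutive malg_star.
Proof. by move=> g; apply/malgP => k; rewrite !mcoeff_star invK conjCK. Qed.

Lemma malg_star_sum (I : Type) (r : seq I) (F : I -> {malg C[K]}) :
  malg_star (\sum_(i <- r) F i) = \sum_(i <- r) malg_star (F i).
Proof.
apply: (big_morph _ malg_starD).
by apply/malgP => k; rewrite mcoeff_star !mcoeff0 conjC0.
Qed.

Lemma malg_starU c k : malg_star << c *g k >> = << c^* *g inv k >>.
Proof.
apply/malgP => l; rewrite mcoeff_star !mcoeffU (can2_eq invK invK).
by case: eqP; rewrite ?mulr1n ?mulr0n ?conjC0.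
Qed.

Lemma malg_starM g h : malg_star (g * h) = malg_star h * malg_star g.
Proof.
rewrite malgM_def fgmulr malg_star_sum mulr_suml; apply: eq_bigr => l _.
rewrite malg_star_sum mulr_sumr; apply: eq_bigr => k _.
by rewrite malg_starU malgM_def fgmulUU invM rmorphM mulrC.
Qed.

Context (phi : K -> C).

Definition malg_state (g : {malg C[K]}) : C := mmap idfun phi g.

Lemma malg_stateU c k : malg_state << c *g k >> = c * phi k.
Proof. exact: mmapU. Qed.

Lemma malg_state_scalar : scalar malg_state.
Proof.
move=> c g h; rewrite /malg_state raddfD /=; congr (_ + _).
(* The support of [c *: g] may be smaller than that of [g]; both sums are taken over the latter. *)
rewrite (mmapEw (msuppZ_le c g)) mmapE mulr_sumr.
by apply: eq_bigr => k _; rewrite mcoeffZ mulrA.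
Qed.

Lemma malg_state1 : phi mone = 1 -> malg_state 1 = 1.
Proof. by move=> phi1; rewrite malg_stateU phi1 mulr1. Qed.

Lemma malg_state_star g :
  (forall k, phi (inv k) = (phi k)^*) -> malg_state (malg_star g) = (malg_state g)^*.
Proof.
move=> phiC; rewrite /malg_star /malg_state raddf_sum rmorph_sum /=.
apply: eq_bigr => k _; rewrite -[LHS]/(malg_state _) malg_stateU.
by rewrite phiC rmorphM.
Qed.

End StarAlgebra.

(** * The free *-algebra on two generators and its state *)

Section Model.
Context (R : realType).

(* (true, e) stands for starpow x e and (false, e) for starpow y e. *)
Definition letter := (bool * bool)%type.

Definition flip_star (l : letter) : letter := (l.1, ~~ l.2).

Definition word_star (w : {fmonom letter}) : {fmonom letter} :=
  FMonom (rev (map flip_star w)).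

Lemma word_starK : involutive word_star.
Proof.
move=> w; apply/eqP; rewrite fmP /= -map_rev revK -map_comp.
by apply/eqP; rewrite -[RHS]map_id; apply: eq_map => -[s e]; rewrite /flip_star /= negbK.
Qed.

Lemma word_starM v w : word_star (mmul v w) = mmul (word_star w) (word_star v).
Proof.
by apply/eqP; rewrite fmP fmM /= fmM map_cat rev_cat.
Qed.

Definition stars (s : bool) (w : seq letter) : seq bool :=
  [seq l.2 | l <- w & l.1 == s].

(** The order of [schi] reverses the right letters, so nesting pairs the k-th left letter with the
    k-th right one; hence no reversal here. *)
Definition mirrored (w : seq letter) : bool :=
  stars true w == map negb (stars false w).

Lemma stars_rev s w : stars s (rev (map flip_star w)) = rev (map negb (stars s w)).
Proof.
by rewrite /stars filter_rev map_rev filter_map -!map_comp.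
Qed.

(** The star reverses and negates both subwords alike, and these operations are injective. *)
Lemma mirrored_star w : mirrored (word_star w) = mirrored w.
Proof.
rewrite /mirrored !stars_rev map_rev (inj_eq (can_inj revK)).
by rewrite (inj_eq (inj_map (can_inj negbK))).
Qed.

Definition word_state (w : {fmonom letter}) : R[i] := (mirrored w)%:R.

Lemma word_state_star w : word_state (word_star w) = (word_state w)^*.
Proof. by rewrite /word_state mirrored_star conjC_nat. Qed.

Lemma word_state1 : word_state mone = 1.
Proof. by rewrite /word_state fm1. Qed.

HB.instance Definition _ := GRing.isLinear.Build R[i]
  (monoid_alg R[i] {fmonom letter}) R[i] *%R (malg_state word_state)
  (malg_state_scalar word_state).

Definition model : star_prob_space R :=
  @StarProbSpace R (monoid_alg R[i] {fmonom letter}) (malg_star word_star)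
    (malg_starD word_starK) (malg_starZ word_starK)
    (malg_starM word_starK word_starM) (malg_starK word_starK)
    (malg_state word_state) (malg_state1 word_state1)
    (fun g => malg_state_star g word_state_star).

Definition gen (s : bool) : model := << FMonom [:: (s, false)] >>.

Lemma state_word (w : seq letter) :
  state model (\prod_(l <- w) starpow (gen l.1) l.2) = (mirrored w)%:R.
Proof.
have genE (l : letter) : starpow (gen l.1) l.2 = << FMonom [:: l] >> :> model.
  case: l => s [] //; apply: etrans (malg_starU word_starK _ _) _.
  by rewrite conjC1.
suff -> : \prod_(l <- w) starpow (gen l.1) l.2 = << FMonom w >> :> model.
  by rewrite /= malg_stateU mul1r.
elim: w => [|l w IHw].
  by rewrite big_nil; congr mkmalgU; apply/eqP; rewrite fmP fm1.
rewrite big_cons IHw genE [LHS]fgmulUU mulr1; congr mkmalgU.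
by apply/eqP; rewrite fmP fmM.
Qed.

End Model.

(** * Non-crossing pairings between an initial segment and its complement *)

Section NestedPairing.
Context (n : nat).

Lemma block_eq (rho : {set {set 'I_n}}) (V W : {set 'I_n}) i :
  noncrossing rho -> V \in rho -> W \in rho -> i \in V -> i \in W -> V = W.
Proof.
case/andP=> /and3P[_ tI _] _ Vr Wr iV iW.
by rewrite -(def_pblock tI Vr iV) (def_pblock tI Wr iW).
Qed.

Lemma noncrossing_pairs (rho : {set {set 'I_n}}) (i j k l : 'I_n) :
  noncrossing rho -> [set i; k] \in rho -> [set j; l] \in rho ->
  (i < j)%N -> (j < k)%N -> (k < l)%N -> False.
Proof.
move=> nc ikr jlr ij jk kl.
case/andP: (nc) => _ /forall_inP/(_ _ ikr)/forall_inP/(_ _ jlr)/implyP.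
have neq : [set i; k] != [set j; l].
  apply/eqP => /setP/(_ i); rewrite !inE eqxx /= => /esym/orP[]/eqP E.
    by rewrite E ltnn in ij.
  by have := ltn_trans (ltn_trans ij jk) kl; rewrite E ltnn.
move=> /(_ neq)/negP; apply.
apply/exists_inP; exists i; rewrite ?inE ?eqxx //.
apply/exists_inP; exists j; rewrite ?inE ?eqxx //.
apply/exists_inP; exists k; rewrite ?inE ?eqxx ?orbT //.
apply/exists_inP; exists l; rewrite ?inE ?eqxx ?orbT //.
by rewrite ij jk kl.
Qed.

(** For odd [n] the middle index forms a singleton block. *)
Definition nested_pairing : {set {set 'I_n}} :=
  [set [set i; rev_ord i] | i : 'I_n].

(** An element determines its block, whence disjointness. In a crossing i < j < k < l, k and l would
    be the reverses of i and j, but reversal inverts the order. *)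
Lemma nested_pairing_noncrossing : noncrossing nested_pairing.
Proof.
have revE (i j : 'I_n) :
    (j \in [set i; rev_ord i]) = ([set i; rev_ord i] == [set j; rev_ord j]).
  apply/idP/eqP => [|->]; last by rewrite !inE eqxx.
  by rewrite !inE => /orP[]/eqP -> //; rewrite rev_ordK setUC.
apply/andP; split.
  apply/and3P; split.
  - rewrite eqEsubset subsetT; apply/subsetP => i _.
    apply/bigcupP; exists [set i; rev_ord i]; first exact: imset_f.
    by rewrite !inE eqxx.
  - apply/trivIsetP => _ _ /imsetP[i _ ->] /imsetP[j _ ->] neq.
    apply/pred0P => k /=; apply: contraNF neq => /andP[].
    by rewrite !revE => /eqP -> /eqP ->.
  - apply/imsetP => -[i _] /setP/(_ i).
    by rewrite !inE eqxx.
apply/forall_inP => _ /imsetP[a _ ->]; apply/forall_inP => _ /imsetP[b _ ->].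
apply/implyP => _; apply/negP.
move=> /exists_inP[i ia /exists_inP[j jb /exists_inP[k ka]]].
move=> /exists_inP[l lb /and3P[ij jk kl]].
have outer (c d e : 'I_n) : c \in [set e; rev_ord e] ->
    d \in [set e; rev_ord e] -> (c < d)%N -> d = rev_ord c.
  rewrite !inE => /orP[]/eqP-> /orP[]/eqP-> //; rewrite ?ltnn ?rev_ordK //.
have Ek := outer _ _ _ ia ka (ltn_trans ij jk).
have El := outer _ _ _ jb lb (ltn_trans jk kl).
move: kl; rewrite Ek El /= ltnNge => /negP; apply.
by rewrite leq_sub2l // ltnS ltnW.
Qed.

(** Every block joins the initial segment [p] to its complement, and two such blocks cross unless
    one encloses the other. *)
Lemma noncrossing_nested (p : pred 'I_n) (rho : {set {set 'I_n}}) :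
  (forall i j : 'I_n, (i <= j)%N -> p j -> p i) ->
  noncrossing rho ->
  (forall V, V \in rho -> #|V| = 2 /\ {in V &, forall i j, i != j -> p i != p j}) ->
  rho = nested_pairing.
Proof.
move=> pdown nc pairs.
have beq V W i := @block_eq rho V W i nc.
have partner i : exists2 j, [set i; j] \in rho & p i != p j.
  have /and3P[/eqP cov _ _] := proj1 (andP nc).
  have : i \in cover rho by rewrite cov inE.
  case/bigcupP => V Vr iV; have [V2 Vp] := pairs _ Vr.
  have /cards2P[a [b [ab VE]]] : #|V| == 2 by rewrite V2.
  have := Vp a b; rewrite VE !inE !eqxx orbT => /(_ isT isT ab) pab.
  move: iV; rewrite VE !inE => /orP[]/eqP ->; first by exists b => //; rewrite -VE.
  by exists a; rewrite 1?eq_sym // setUC -VE.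
(* Induction on i: a partner to the right of rev_ord i already belongs to an earlier
   block, and one to its left would make the block of rev_ord i cross that of i. *)
have left_block (i : 'I_n) : p i -> [set i; rev_ord i] \in rho.
  have [m] := ubnP (i : nat); elim: m i => // m IH i; rewrite ltnS => im pi.
  have IHi (j : 'I_n) : (j < i)%N -> [set j; rev_ord j] \in rho.
    move=> ji; apply: IH; first exact: leq_trans ji im.
    exact: (pdown j i (ltnW ji)).
  have [q iq piq] := partner i; have npq : ~~ p q by move: piq; rewrite pi.
  have iNq : i != q by apply: contraNneq npq => <-.
  case: (ltngtP q (rev_ord i)) => [qr|rq|/val_inj <- //].
  - set r := rev_ord i in qr.
    have npr : ~~ p r by apply: contra npq; apply: pdown (ltnW qr).
    (* The partner [t] of [r] lies in [p]. If [t < i], its block is already known and misses [r]; if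
       [t > i], the blocks cross at [i < t < q < r]; if [t = i], then [i] has two partners. *)
    have [t rt prt] := partner r.
    have pt : p t by move: prt; rewrite (negbTE npr); case: (p t).
    case: (ltngtP t i) => [ti|it|/val_inj ti].
    + have E : [set r; t] = [set t; rev_ord t].
        by apply: (beq _ _ t); rewrite ?IHi ?inE ?eqxx ?orbT.
      have : r \in [set t; rev_ord t] by rewrite -E !inE eqxx.
      rewrite !inE => /orP[/eqP rE|/eqP/rev_ord_inj iE].
        by rewrite rE pt in npr.
      by rewrite iE ltnn in ti.
    + have tq : (t < q)%N.
        by rewrite ltnNge; apply: contra npq => qt; apply: pdown qt pt.
      exfalso; apply: (@noncrossing_pairs rho i t q r) => //.
      by rewrite setUC.
    + have E : [set r; i] = [set i; q].
        by rewrite -{1}ti; apply: (beq _ _ t); rewrite ?ti ?inE ?eqxx ?orbT // -ti.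
      have : q \in [set r; i] by rewrite E !inE eqxx orbT.
      rewrite !inE => /orP[]/eqP qE; first by rewrite qE ltnn in qr.
      by rewrite qE pi in npq.
  - have ji : (rev_ord q < i)%N.
      rewrite ltnNge; apply: contraTN rq => le_iq.
      by rewrite -leqNgt -(rev_ordK q) leq_sub2l.
    have E : [set i; q] = [set rev_ord q; rev_ord (rev_ord q)].
      by apply: (beq _ _ q); rewrite ?IHi ?inE ?rev_ordK ?eqxx ?orbT.
    have : i \in [set rev_ord q; rev_ord (rev_ord q)] by rewrite -E !inE eqxx.
    rewrite rev_ordK !inE => /orP[]/eqP iE; last by rewrite iE eqxx in iNq.
    by rewrite -iE ltnn in ji.
(* An index outside [p] has its partner in [p], where the block is known. *)
have block i : [set i; rev_ord i] \in rho.
  have [/left_block //|npi] := boolP (p i).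
  have [j ij pij] := partner i.
  have pj : p j by move: pij; rewrite (negbTE npi); case: (p j).
  have E : [set i; j] = [set j; rev_ord j].
    by apply: (beq _ _ j); rewrite ?left_block ?inE ?eqxx ?orbT.
  have : i \in [set j; rev_ord j] by rewrite -E !inE eqxx.
  rewrite !inE => /orP[]/eqP iE; first by rewrite iE pj in npi.
  by rewrite {2}iE rev_ordK.
apply/eqP; rewrite eqEsubset; apply/andP; split; apply/subsetP => V.
  move=> Vr; have /and3P[_ _ n0] := proj1 (andP nc).
  have /set0Pn[i iV] : V != set0 by apply: contraNneq n0 => <-.
  apply/imsetP; exists i => //.
  by apply: (beq _ _ i); rewrite ?inE ?eqxx ?block.
by case/imsetP=> i _ ->; apply: block.
Qed.

End NestedPairing.

(** * Counting bi-non-crossing partitions into dual pairs *)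

Section Dual.
Context (n : nat) (chi : 'I_n -> side) (eta : 'I_n -> bool).

Definition dual (i j : 'I_n) : bool :=
  (is_left (chi i) != is_left (chi j)) && (eta i != eta j).

(** The intended cumulant of the letters in the block [V], as a truth value. *)
Definition dual_pair (V : {set 'I_n}) : bool :=
  (#|V| == 2) && [forall i in V, forall j in V, (i != j) ==> dual i j].

Lemma dual_pairP (V : {set 'I_n}) :
  reflect (#|V| = 2 /\ {in V &, forall i j, i != j -> dual i j}) (dual_pair V).
Proof.
apply: (iffP andP) => -[/eqP V2 VP]; split; rewrite ?V2 //.
  move=> i j iV jV ij; move/forall_inP/(_ i iV): VP.
  by move=> /forall_inP/(_ j jV)/implyP/(_ ij).
apply/forall_inP => i iV; apply/forall_inP => j jV; apply/implyP.
exact: VP.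
Qed.

Lemma dualC i j : dual i j = dual j i.
Proof. by rewrite /dual eq_sym [eta i == _]eq_sym. Qed.

Lemma dual_pair2 i j : i != j -> dual_pair [set i; j] = dual i j.
Proof.
move=> ij; apply/dual_pairP/idP => [[_ /(_ i j)]|dij].
  by rewrite !inE !eqxx orbT; apply.
split=> [|k l]; first by rewrite cards2 ij.
by rewrite !inE => /orP[]/eqP-> /orP[]/eqP->; rewrite ?eqxx // dualC.
Qed.

(** Left positions form an initial segment because [schi_seq] lists them first; this supplies the
    predicate [p] of [noncrossing_nested]. *)
Lemma is_left_schi i :
  is_left (chi (schi chi i)) = (i < count (fun k => is_left (chi k)) (enum 'I_n))%N.
Proof.
rewrite permE nth_cat size_filter; case: ifPn => [lt|ge].
  have : nth i [seq k <- enum 'I_n | is_left (chi k)] i \in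
      [seq k <- enum 'I_n | is_left (chi k)] by rewrite mem_nth ?size_filter.
  by rewrite mem_filter => /andP[].
set s := rev _; set j := (_ - _)%N.
have : nth i s j \in s.
  (* The shifted index is in range because the left and right counts add up to [n]. *)
  rewrite mem_nth // /s size_rev size_filter /j.
  have := count_predC (fun k => is_left (chi k)) (enum 'I_n).
  rewrite size_enum_ord => E.
  rewrite -leqNgt in ge.
  rewrite -subSn // leq_subLR.
  rewrite -[X in (_ <= X)%N]/(_ + count (predC (fun k => is_left (chi k))) _)%N.
  by rewrite E.
by rewrite mem_rev mem_filter => /andP[/negbTE].
Qed.

Definition letters : seq letter := [seq (is_left (chi i), eta i) | i <- enum 'I_n].

(** In the order of [schi] the word is [t], the left subword followed by the reversed right one.
    With [g] flipping side and star, both conditions say that [t] equals the reverse of its image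
    under [g]. *)
Lemma mirrored_letters :
  mirrored letters = [forall i, dual (schi chi i) (schi chi (rev_ord i))].
Proof.
pose g (l : letter) : letter := (~~ l.1, ~~ l.2).
pose t : seq letter := [seq (is_left (chi i), eta i) | i <- schi_seq chi].
have st : size t = n by rewrite size_map (perm_size (perm_schi_seq chi)) size_enum_ord.
have tE : t = map (pair true) (stars true letters) ++
              rev (map (pair false) (stars false letters)).
  rewrite /t map_cat map_rev /stars /letters !filter_map -!map_comp; congr (_ ++ rev _).
    rewrite [in RHS](eq_filter (_ : _ =1 fun i => is_left (chi i))) => [|i /=];
      last by case: is_left.
    by apply/eq_in_map => i; rewrite mem_filter /= => /andP[-> _].
  rewrite [in RHS](eq_filter (_ : _ =1 fun i => ~~ is_left (chi i))) => [|i /=];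
    last by case: is_left.
  by apply/eq_in_map => i; rewrite mem_filter /= => /andP[/negbTE -> _].
have -> : mirrored letters = (t == rev (map g t)).
  apply/eqP/eqP => [E|].
    rewrite tE E map_cat rev_cat map_rev revK -!map_comp.
    by congr (_ ++ rev _); apply: eq_map => e; rewrite /g /= ?negbK.
  have starsE s e r : stars s (map (pair e) r) = if e == s then r else [::].
    rewrite /stars filter_map -map_comp; case: ifP => es.
      by rewrite (eq_filter (_ : _ =1 predT)) ?filter_predT ?map_id.
    by rewrite (eq_filter (_ : _ =1 pred0)) ?filter_pred0.
  have stars_cat s u v : stars s (u ++ v) = stars s u ++ stars s v.
    by rewrite /stars filter_cat map_cat.
  have starsr s u : stars s (rev u) = rev (stars s u).
    by rewrite /stars filter_rev map_rev.
  (* The left letters of the two sides already give the required equality. *)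
  move/(congr1 (stars true)).
  rewrite tE map_cat map_rev rev_cat revK !stars_cat starsr.
  have gE e r : map g (map (pair e) r) = map (pair (~~ e)) (map negb r).
    by rewrite -!map_comp; apply: eq_map.
  by rewrite !gE !starsr !starsE /= cats0 cats0.
have nthE (x : letter) (i : 'I_n) : nth x t i =
    (is_left (chi (schi chi i)), eta (schi chi i)).
  rewrite (nth_map i); first by rewrite permE.
  by rewrite (perm_size (perm_schi_seq chi)) size_enum_ord.
have revE (x : letter) (i : 'I_n) : nth x (rev (map g t)) i =
    g (is_left (chi (schi chi (rev_ord i))), eta (schi chi (rev_ord i))).
  have lt : (n - i.+1 < n)%N := ltn_ord (rev_ord i).
  rewrite nth_rev; last by rewrite size_map st ltn_ord.
  rewrite size_map st (nth_map x); last by rewrite st.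
  by rewrite -(nthE x (rev_ord i)).
apply/eqP/forallP => [E i|d].
  have := revE (true, true) i; rewrite -E nthE /g /dual => -[-> ->] /=.
  by case: is_left; case: eta.
apply: (@eq_from_nth _ (true, true)); first by rewrite size_rev (size_map g).
move=> i; rewrite st => lt; rewrite (nthE _ (Ordinal lt)) (revE _ (Ordinal lt)).
have := d (Ordinal lt); rewrite /dual /g /=.
by do 2!case: is_left; do 2!case: eta.
Qed.

(** Each product is 1 if all blocks are dual pairs and 0 otherwise. Pulled back along [schi], a
    surviving partition must be the nested pairing, so at most one term remains. *)
Lemma sum_dual_pairs (C : comNzRingType) :
  \sum_(pi in BNC chi) \prod_(V in pi) (dual_pair V)%:R = (mirrored letters)%:R :> C.
Proof.
pose s (V : {set 'I_n}) : {set 'I_n} := schi chi @: V.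
pose pi0 := s @: nested_pairing n.
have prodE (pi : {set {set 'I_n}}) :
    \prod_(V in pi) (dual_pair V)%:R = [forall V in pi, dual_pair V]%:R :> C.
  have [/forall_inP all|] := boolP [forall V in pi, dual_pair V].
    by rewrite big1 // => V /all ->.
  rewrite negb_forall_in => /exists_inP[V Vpi /negbTE nV].
  by rewrite (bigD1 V) //= nV mul0r.
have pi0B : pi0 \in BNC chi.
  by apply: imset_f; rewrite inE nested_pairing_noncrossing.
rewrite (bigD1 pi0) //= prodE big1; last first.
  move=> pi /andP[/imsetP[rho]].
  rewrite inE => nc ->; rewrite prodE; case: forall_inP => // d /eqP[].
  suff -> : rho = nested_pairing n by [].
  apply: (@noncrossing_nested _ (fun i => is_left (chi (schi chi i)))) => //.
    by move=> i j ij; rewrite !is_left_schi; apply: leq_ltn_trans.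
  move=> V Vr; have /dual_pairP[c2 dV] := d _ (imset_f s Vr).
  split=> [|i j iV jV ij]; first by rewrite -c2 card_imset //; exact: perm_inj.
  have := dV (schi chi i) (schi chi j); rewrite !imset_f // => /(_ isT isT).
  by rewrite (inj_eq perm_inj) => /(_ ij)/andP[].
rewrite addr0 mirrored_letters; congr (nat_of_bool _)%:R.
have sE i : s [set i; rev_ord i] = [set schi chi i; schi chi (rev_ord i)].
  by rewrite /s imsetU1 imset_set1.
apply/forall_inP/forallP => [d i|d V].
  have /dual_pairP[c2] : dual_pair [set schi chi i; schi chi (rev_ord i)].
    by rewrite -sE d //; do 2!apply: imset_f.
  apply; rewrite ?inE ?eqxx ?orbT //.
  by move: c2; rewrite cards2; case: eqP.
case/imsetP=> _ /imsetP[i _ ->] ->; rewrite sE dual_pair2 //.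
(* Irreflexivity of [dual] rules out a middle index, hence odd [n]. *)
by apply/eqP => E; have := d i; rewrite -E /dual eqxx.
Qed.

End Dual.

Lemma dual_pair_restrict (n : nat) (chi : 'I_n -> side) (eta : 'I_n -> bool)
    (V : {set 'I_n}) :
  dual_pair (restrict chi V) (restrict eta V) [set: _] = dual_pair chi eta V.
Proof.
apply/dual_pairP/dual_pairP; rewrite cardsT card_ord => -[V2 dV]; split=> // i j.
  move=> iV jV ij.
  have := dV (enum_rank_in iV i) (enum_rank_in iV j).
  rewrite !inE /dual /restrict !enum_rankK_in //; apply=> //.
  apply: contra_neq ij => /(congr1 enum_val).
  by rewrite !enum_rankK_in.
move=> _ _ ij; have := dV (enum_val i) (enum_val j).
by rewrite !enum_valP (inj_eq enum_val_inj); apply.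
Qed.

(** * Cumulants of the generators, R-diagonality and failure of bi-freeness *)

Section Model.
Context (R : realType).

Definition entry (s : side) (e : bool) : model R :=
  starpow (if is_left s then gen R true else gen R false) e.

Lemma state_letters (n : nat) (chi : 'I_n -> side) (eta : 'I_n -> bool) :
  state (model R) (\prod_(i < n) entry (chi i) (eta i)) = (mirrored (letters chi eta))%:R.
Proof.
rewrite -state_word /letters big_map enumT [index_enum _]unlock; congr (state _ _).
by apply: eq_bigr => i _; rewrite /entry; case: (chi i).
Qed.

(** Both sides satisfy the moment-cumulant formula on letters. By strong induction the terms of all
    other partitions agree, hence so do the one-block terms. [cumulant_unique] would require a
    formula for arbitrary arguments. *)
Lemma cumulant_model (n : nat) (chi : 'I_n -> side) (eta : 'I_n -> bool) :
  (0 < n)%N ->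
  cumulant chi (fun i => entry (chi i) (eta i)) = (dual_pair chi eta [set: 'I_n])%:R.
Proof.
have [m] := ubnP n; elim: m n chi eta => // m IH n chi eta; rewrite ltnS => nm n0.
have := moment_cumulant chi (fun i => entry (chi i) (eta i)).
rewrite state_letters -sum_dual_pairs.
rewrite (bigD1 [set [set: 'I_n]]) ?setT1_BNC //= big_set1.
rewrite [RHS](bigD1 [set [set: 'I_n]]) ?setT1_BNC //= big_set1.
rewrite (cumulant_restrictT (@cumulant R (model R))) => E.
apply/esym; move: E; set S1 := \sum_(_ in _ | _) _; set S2 := \sum_(_ in _ | _) _.
suff -> : S1 = S2 by move/addIr.
apply: eq_bigr => pi /andP[piB pin1]; apply: eq_bigr => V Vpi.
have Ppi := BNC_partition piB; have Vn := block_lt Ppi pin1 Vpi.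
rewrite -dual_pair_restrict; apply/esym/IH; first exact: leq_trans Vn nm.
rewrite card_gt0; have [_ _] := and3P Ppi.
by apply: contraNneq => <-.
Qed.

Lemma dual_pair_alternating (m : nat) (chi : 'I_m -> side) (eta : 'I_m -> bool) :
  dual_pair chi eta [set: 'I_m] ->
  exists n k : nat, exists omega : 'I_m -> bool,
        [/\ m = (2 * n)%N, (k <= m)%N,
            forall i j : 'I_m, j = i.+1 :> nat -> omega i != omega j &
            forall i : 'I_m, (chi (schi chi i), eta (schi chi i)) =
              (if (i < k)%N then sl else sr, omega i)].
Proof.
case/dual_pairP; rewrite cardsT card_ord => m2 d.
have dij (i j : 'I_m) : j = i.+1 :> nat -> dual chi eta (schi chi i) (schi chi j).
  move=> ji; apply: d; rewrite ?inE // (inj_eq perm_inj).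
  by apply/eqP => E; have := ltnn i; rewrite {2}E ji leqnn.
(* A dual pair has length 2 and, in the order of [schi], one left letter followed by one right
   letter. *)
exists 1%N, 1%N, (fun i => eta (schi chi i)); split; rewrite ?m2 //.
  by move=> i j /dij/andP[].
move=> i; congr pair.
have lt0 : (0 < m)%N by rewrite m2.
have lt1 : (1 < m)%N by rewrite m2.
have /andP[d01 _] := dij (Ordinal lt0) (Ordinal lt1) erefl.
move: d01; rewrite !is_left_schi /=; set c := count _ _ => d01.
(* Exactly one of the positions 0 and 1 is below the number [c] of left letters. *)
have c1 : c = 1%N by move: d01; case: (c) => [|[]].
have := is_left_schi chi i; rewrite -/c c1.
by case: (chi _) => /= <-.
Qed.

Lemma model_r_diagonal : r_diagonal (gen R true) (gen R false).
Proof.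
(* The empty word is alternating, so only nonempty words remain for [cumulant_model]. *)
move=> [|m] chi eta nalt.
  by case: nalt; exists 0%N, 0%N, eta; split=> // -[i i0];
    have := i0; rewrite ltn0.
rewrite -[LHS]/(cumulant chi (fun i => entry (chi i) (eta i))) cumulant_model //.
by case dE: (dual_pair _ _ _) => //; case: nalt; apply: dual_pair_alternating dE.
Qed.

Lemma cumulant1 (A : star_prob_space R) (chi : 'I_1 -> side) (a : 'I_1 -> A) :
  cumulant chi a = state A (a ord0).
Proof.
rewrite /cumulant /= big_ord1 big1 ?subr0 // => pi /andP[piB pin1].
have Ppi := BNC_partition piB; have [/eqP cov _ _] := and3P Ppi.
have : ord0 \in cover pi by rewrite cov inE.
case/bigcupP => V Vpi V0; have := block_lt Ppi pin1 Vpi.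
by rewrite ltnS leqNgt card_gt0; case/set0Pn; exists ord0.
Qed.

(** Besides the single block there is only the partition into singletons, whose product contains the
    factor [state A (a ord0)], which is 0. *)
Lemma cumulant2_neq0 (A : star_prob_space R) (chi : 'I_2 -> side) (a : 'I_2 -> A) :
  state A (a ord0) = 0 -> state A (a ord0 * a ord_max) != 0 -> cumulant chi a != 0.
Proof.
move=> a0; apply: contra_neq => k0.
have -> : a ord0 * a ord_max = \prod_(i < 2) a i.
  by rewrite big_ord_recl big_ord1; congr (_ * a _); apply/val_inj.
rewrite (moment_cumulant chi) big1 // => pi piB.
have [->|pin1] := eqVneq pi [set [set: 'I_2]].
  by rewrite big_set1 (cumulant_restrictT (@cumulant R A)).
have Ppi := BNC_partition piB; have [/eqP cov _ _] := and3P Ppi.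
have : ord0 \in cover pi by rewrite cov inE.
case/bigcupP => V Vpi V0; rewrite (bigD1 V) //=.
have V1 : V = [set ord0].
  apply/esym/eqP; rewrite eqEcard sub1set V0 cards1 /=.
  exact: block_lt Ppi pin1 Vpi.
suff -> : cumulant (restrict chi V) (restrict a V) = 0 by rewrite mul0r.
(* Generalizing the size lets the index type ['I_#|V|] be replaced by ['I_1]. *)
have aux (m : nat) (c : 'I_m -> side) (b : 'I_m -> A) : m = 1%N ->
    (forall i, b i = a ord0) -> cumulant c b = 0.
  by move=> m1; move: c b; rewrite m1 => c b bE; rewrite cumulant1 bE.
apply: aux; first by rewrite V1 cards1.
move=> i; rewrite /restrict; congr a.
by have := enum_valP i; rewrite {2}V1 inE => /eqP.
Qed.

Lemma state_xxs (x := gen R true) : state (model R) (x * adj x) = 0.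
Proof.
have -> : x * adj x =
    \prod_(l <- [:: (true, false); (true, true)]) starpow (gen R l.1) l.2.
  by rewrite big_cons big_seq1.
by rewrite state_word.
Qed.

(** The left subword [x x^*] is letterwise dual to the right subword [y^* y]. *)
Lemma state_xxsysy (x := gen R true) (y := gen R false) :
  state (model R) ((x * adj x) * (adj y * y)) = 1.
Proof.
have -> : x * adj x * (adj y * y) =
    \prod_(l <- [:: (true, false); (true, true); (false, true); (false, false)])
      starpow (gen R l.1) l.2.
  by rewrite 3!big_cons big_seq1 -(mulrA x (adj x)).
by rewrite state_word.
Qed.

Lemma model_not_bi_free (x := gen R true) (y := gen R false) :
  ~ bi_free (x * adj x, y * adj y) (adj x * x, adj y * y).
Proof.
(* The left variable of the first pair is followed by the right variable of the second. *)
pose chi (i : 'I_2) := if i == ord0 then sl else sr.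
pose eps (i : 'I_2) := i != ord0.
move=> /(_ 2%N chi eps isT) kappa0.
have /kappa0 : exists i j, eps i != eps j by exists ord0, ord_max.
apply/eqP; apply: cumulant2_neq0; first exact: state_xxs.
have -> : eps ord_max = true by [].
by rewrite state_xxsysy oner_neq0.
Qed.

End Model.

Theorem theorem2p7 (R : realType) :
  exists (A : star_prob_space R) (x y : A),
    r_diagonal x y /\
    ~ bi_free (x * adj x, y * adj y) (adj x * x, adj y * y).
Proof.
exists (model R), (gen R true), (gen R false).
by split; [exact: model_r_diagonal|exact: model_not_bi_free].
Qed.
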